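(* Let $a, a_1, b, b_1, c, k$ be six points and $A, B, C$ three concurrent lines in $\mathbb{P}^2$, in general linear position, and let $$Q=\{x\in\mathbb{P}^2 : (xaAa_1\,.\,xbBkCb_1\,.\,xc)=0\}$$ be the cubic they define (it contains $a$ and $b$). Then the third point of intersection of the line $ab$ with the cubic $Q$ is $$\big((abAa_1\,.\,abBkCb_1)\,c\big)\,.\,ab ,$$ that is, setting $p$ equal to the meet of the lines $abAa_1$ and $abBkCb_1$, it is the meet of the line $pc$ with the line $ab$.
   Context: Work in the projective plane $\mathbb{P}^2$ over a field (e.g. $\mathbb{R}$ or $\mathbb{C}$). Points are nonzero vectors $[x_0:x_1:x_2]$ up to scaling; a line $L_0x_0+L_1x_1+L_2x_2=0$ is represented by its coefficient vector $[L_0:L_1:L_2]$ up to scaling. A zero point $[0:0:0]$ and a zero line $[0:0:0]$ are allowed as degenerate values. Lower case letters denote points, upper case letters denote lines. The join of points $p,q$ is the line $pq:=p\times q$ (cross product), and the meet of lines $L,M$ is the point $LM:=L\times M$ (so $pp$ and $LL$ are zero). If $L$ is a line and $r$ a point, $Lr$ is the scalar $L\cdot r$, which vanishes iff $r$ lies on $L$ (or something is zero). For three points, or three lines, the bracket is $(u.v.w)=u\cdot(v\times w)$; only its vanishing matters. Thus for lines $(L.M.R)=0$ iff the lines share a common point, two coincide, or one is the zero line. Expressions are evaluated from left to right, with periods (and parentheses) separating factors that are evaluated first: for example $xaAa_1$ is the line joining $a_1$ to the meet of the line $xa$ with $A$; $xbBkCb_1=((((xb)B)k)C)b_1$ is a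 line; and $pq.rs$ denotes the meet of the lines $pq$ and $rs$. The expression $F(x)=(xaAa_1.xbBkCb_1.xc)$, computed with fixed vector representatives, is a homogeneous cubic form in $x=(x_0,x_1,x_2)$, and $Q$ is its zero set. Intersections with a line are counted with multiplicity: the ''third point of intersection'' of $ab$ with $Q$ is the point $y$ such that the roots of the nonzero cubic form $F|_{ab}$ on the line $ab$, with multiplicity, are $a$, $b$, $y$. ''General linear position'' means that no unexpected linear coincidences occur; in particular $a\neq b$, and all the points and lines arising in the evaluation of the expression for the third point are nonzero. *)

(* Defs.v *)
From HB Require Import structures.
From mathcomp Require Import all_boot all_order all_algebra.
From mathcomp Require Import mpoly.

Set Implicit Arguments.
Unset Strict Implicit.
Unset Printing Implicit Defensive.

Import GRing.Theory.
Local Open Scope ring_scope.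

(* Points and lines of P^2 are both given by coordinate vectors in 'rV_3, and
   [0:0:0] is a possible value of a join or a meet.  Two nonzero vectors u, v
   are the same point when they span the same row space, (u == v)%MS. *)

(* The indices i + 1 and i + 2 are taken in 'I_3 = Z/3. *)
Definition cross (R : comNzRingType) (u v : 'rV[R]_3) : 'rV[R]_3 :=
  \row_(i < 3) (u 0 (i + 1) * v 0 (i + 2%:R) - u 0 (i + 2%:R) * v 0 (i + 1)).

(* Left associative, so that a word such as xaAa_1 is x *v a *v A *v a1. *)
Notation "u *v w" := (cross u w) (at level 40, left associativity) : ring_scope.

Definition dot (R : comNzRingType) (u v : 'rV[R]_3) : R :=
  \sum_(i < 3) u 0 i * v 0 i.

Definition bracket (R : comNzRingType) (u v w : 'rV[R]_3) : R :=
  dot u (v *v w).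

(* (xaAa_1 . xbBkCb_1 . xc), over any commutative ring so that x may also be
   the generic point. *)
Definition cubic_expr (R : comNzRingType)
    (a a1 b b1 c k A B C x : 'rV[R]_3) : R :=
  bracket (x *v a *v A *v a1) (x *v b *v B *v k *v C *v b1) (x *v c).

Definition cubic_curve (K : fieldType) (a a1 b b1 c k A B C : 'rV[K]_3)
    (x : 'rV[K]_3) : Prop :=
  cubic_expr a a1 b b1 c k A B C x = 0.

Definition cubic_form (K : fieldType) (a a1 b b1 c k A B C : 'rV[K]_3) :
    {mpoly K[3]} :=
  let cst := map_mx (mpolyC 3 (R := K)) in
  cubic_expr (cst a) (cst a1) (cst b) (cst b1) (cst c) (cst k)
    (cst A) (cst B) (cst C) (\row_(i < 3) 'X_i).

(* F (x + T z) as a polynomial in T: the restriction of F to the line joining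
   x and z, in the affine coordinate of that line centred at x. For F
   homogeneous it is nonzero iff the binary form F (s x + t z) is. *)
Definition restrict_line (K : fieldType) (F : {mpoly K[3]}) (x z : 'rV[K]_3) :
    {poly K} :=
  mmap (polyC (R := K)) (fun i => (x 0 i)%:P + (z 0 i)%:P * 'X) F.

(* F restricts to a nonzero cubic form on the line ab, whose roots with
   multiplicity are a, b and y: at every point x of ab the multiplicity, which
   may be computed with any second point z of ab, is the number of occurrences
   of x in the list a, b, y. *)
Definition is_third_point (K : fieldType) (F : {mpoly K[3]})
    (a b y : 'rV[K]_3) : Prop :=
  [/\ F \is 3.-homog, restrict_line F a b != 0,
      y != 0 /\ dot (a *v b) y = 0
    & forall x z : 'rV[K]_3,
        dot (a *v b) x = 0 -> dot (a *v b) z = 0 -> x *v z != 0 ->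
        mup 0 (restrict_line F x z) =
          ((x == a)%MS + (x == b)%MS + (x == y)%MS)%N].

(* The nondegeneracy contained in any reading of general linear position: the
   data and every point and line met while evaluating the expression
   M *v N *v c *v (a *v b) of the third point, itself included, are nonzero.
   In particular a *v b != 0, that is, a and b are distinct points. *)
Definition general_position (K : fieldType)
    (a a1 b b1 c k A B C : 'rV[K]_3) : Prop :=
  let M := a *v b *v A *v a1 in
  let N := a *v b *v B *v k *v C *v b1 in
  [/\ 0 \notin [:: a; a1; b; b1; c; k],
      0 \notin [:: A; B; C],
      0 \notin [:: a *v b; a *v b *v A; M],
      0 \notin [:: a *v b *v B; a *v b *v B *v k; a *v b *v B *v k *v C; N]
    & 0 \notin [:: M *v N; M *v N *v c; M *v N *v c *v (a *v b)]].

(* Main.v *)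
Require Import Defs.
From HB Require Import structures.
From mathcomp Require Import all_boot all_order all_algebra.
From mathcomp Require Import mpoly ring.

(** With L = ab and x = s a + t b one has xa = - t L and xb = s L.  The line
    xaAa_1 is therefore the fixed line M = abAa_1 up to the factor - t, and
    xbBkCb_1 is the fixed line N = abBkCb_1 up to the factor s.  Hence, with
    p = MN, the cubic form restricts to s t (x . pc), whose roots on ab are
    a, b and the meet of pc with ab. *)

Set Implicit Arguments.
Unset Strict Implicit.
Unset Printing Implicit Defensive.

Import GRing.Theory.
Local Open Scope ring_scope.

(** * Polynomial identities between cross and dot products, over any commutative ring *)

Section CrossProduct.
Variable R : comNzRingType.
Implicit Types (u v w a b : 'rV[R]_3) (r s t : R).

Lemma ord3P (P : 'I_3 -> Prop) : P 0 -> P 1 -> P 2%:R -> forall i, P i.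
Proof.
move=> P0 P1 P2 [[|[|[|//]]] lt_i3].
- by rewrite (_ : Ordinal _ = 0) //; apply/val_inj.
- by rewrite (_ : Ordinal _ = 1) //; apply/val_inj.
- by rewrite (_ : Ordinal _ = 2%:R) //; apply/val_inj.
Qed.

Lemma cross_coord u v :
  [/\ (u *v v) 0 0 = u 0 1 * v 0 2%:R - u 0 2%:R * v 0 1,
      (u *v v) 0 1 = u 0 2%:R * v 0 0 - u 0 0 * v 0 2%:R
    & (u *v v) 0 2%:R = u 0 0 * v 0 1 - u 0 1 * v 0 0].
Proof.
by split; rewrite mxE; congr (u _ _ * v _ _ - u _ _ * v _ _); apply/val_inj.
Qed.

Lemma dotE u v : dot u v = u 0 0 * v 0 0 + u 0 1 * v 0 1 + u 0 2%:R * v 0 2%:R.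
Proof.
rewrite /dot !big_ord_recl big_ord0 addr0 addrA.
by congr (_ * _ + _ * _ + _ * _); congr (_ _ _); apply/val_inj.
Qed.

Let crossE0 u v := let: And3 e _ _ := cross_coord u v in e.
Let crossE1 u v := let: And3 _ e _ := cross_coord u v in e.
Let crossE2 u v := let: And3 _ _ e := cross_coord u v in e.
Let coordE := (crossE0, crossE1, crossE2, dotE).

Ltac cross_ring :=
  rewrite ?/bracket;
  try (apply/rowP; apply: ord3P);
  rewrite ?(coordE, mxE); ring.

Lemma crossvv u : u *v u = 0. Proof. cross_ring. Qed.

Lemma crossC u v : u *v v = - (v *v u). Proof. cross_ring. Qed.

Lemma cross0v u : 0 *v u = 0. Proof. cross_ring. Qed.

Lemma crossZl r u v : (r *: u) *v v = r *: (u *v v). Proof. cross_ring. Qed.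

Lemma cross_lincomb a b s t s' t' :
  (s *: a + t *: b) *v (s' *: a + t' *: b) = (s * t' - t * s') *: (a *v b).
Proof. cross_ring. Qed.

Lemma cross_lincombl a b s t : (s *: a + t *: b) *v a = (- t) *: (a *v b).
Proof. cross_ring. Qed.

Lemma cross_lincombr a b s t : (s *: a + t *: b) *v b = s *: (a *v b).
Proof. cross_ring. Qed.

(** Lagrange's formula. With [u] the line pc it gives the coordinates of the third point in terms of
    [a] and [b]. *)
Lemma double_cross u a b : u *v (a *v b) = dot b u *: a + (- dot a u) *: b.
Proof. cross_ring. Qed.

Lemma dot_crossl a b : dot (a *v b) a = 0. Proof. cross_ring. Qed.

Lemma dot_crossr a b : dot (a *v b) b = 0. Proof. cross_ring. Qed.

Lemma dot_double_cross a b u : dot (a *v b) (u *v (a *v b)) = 0.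
Proof. cross_ring. Qed.

Lemma bracketZZ r s u v w : bracket (r *: u) (s *: v) w = r * s * bracket u v w.
Proof. cross_ring. Qed.

(** The bracket is the triple product of uv, x and c with x = s a + t b; exchanging x and c turns it
    into minus the value at x of the line joining uv to c. *)
Lemma bracket_lincomb u v c a b s t :
  bracket u v ((s *: a + t *: b) *v c) =
  - (s * dot a (u *v v *v c) + t * dot b (u *v v *v c)).
Proof. cross_ring. Qed.

Lemma bracket0l v w : bracket 0 v w = 0. Proof. cross_ring. Qed.

Lemma bracket0m u w : bracket u 0 w = 0. Proof. cross_ring. Qed.

(** Cramer's rule, cleared of denominators: the linear relation between four vectors of a space of
    dimension three. *)
Lemma scale_basis_expansion a b x e :
  dot (a *v b) e *: x =
  dot (x *v b) e *: a + dot (a *v x) e *: b + dot (a *v b) x *: e.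
Proof. cross_ring. Qed.

Lemma cubic_expr_line a a1 b b1 c k A B C s t :
  let q := (a *v b *v A *v a1) *v (a *v b *v B *v k *v C *v b1) *v c in
  cubic_expr a a1 b b1 c k A B C (s *: a + t *: b) =
  s * t * (s * dot a q + t * dot b q).
Proof.
(* The scalars - t and s pass through every later join and meet; the sign of - t cancels the one
   from [bracket_lincomb]. *)
rewrite /cubic_expr cross_lincombl cross_lincombr !crossZl bracketZZ.
rewrite bracket_lincomb; ring.
Qed.

End CrossProduct.

(** * Base change along ring morphisms *)

Section Morphism.
Variables (R S : comNzRingType) (f : {rmorphism R -> S}).
Implicit Types u v w : 'rV[R]_3.

Lemma map_cross u v : map_mx f (u *v v) = map_mx f u *v map_mx f v.
Proof. by apply/rowP => i; rewrite !mxE rmorphB !rmorphM. Qed.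

Lemma dot_map u v : dot (map_mx f u) (map_mx f v) = f (dot u v).
Proof.
by rewrite /dot rmorph_sum; apply: eq_bigr => i _; rewrite !mxE rmorphM.
Qed.

Lemma map_cubic_expr a a1 b b1 c k A B C x :
  f (cubic_expr a a1 b b1 c k A B C x) =
  cubic_expr (map_mx f a) (map_mx f a1) (map_mx f b) (map_mx f b1)
    (map_mx f c) (map_mx f k) (map_mx f A) (map_mx f B) (map_mx f C)
    (map_mx f x).
Proof. by rewrite /cubic_expr /bracket -dot_map !map_cross. Qed.

End Morphism.

(** * Degrees of joins, meets and brackets of forms *)

Section Homogeneity.
Variables (n : nat) (K : fieldType).
Implicit Types u v : 'rV[{mpoly K[n]}]_3.

Lemma cross_homog d e u v :
  (forall i, u 0 i \is d.-homog) -> (forall i, v 0 i \is e.-homog) ->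
  forall i, (u *v v) 0 i \is (d + e).-homog.
Proof.
by move=> hu hv i; rewrite mxE rpredB // dhomogM.
Qed.

Lemma dot_homog d e u v :
  (forall i, u 0 i \is d.-homog) -> (forall i, v 0 i \is e.-homog) ->
  dot u v \is (d + e).-homog.
Proof. by move=> hu hv; apply: rpred_sum => i _; rewrite dhomogM. Qed.

Lemma mpolyC_homog (u : 'rV[K]_3) i :
  (map_mx (mpolyC n (R := K)) u) 0 i \is 0.-homog.
Proof. by rewrite mxE -[_%:MP]mulr1 mul_mpolyC dhomogZ ?dhomog1. Qed.

End Homogeneity.

(** * Points of the line ab and restriction of the cubic to it *)

Section Line.
Variable K : fieldType.
Implicit Types u v a b x : 'rV[K]_3.

Lemma sub_cross0 u v : v != 0 -> u *v v = 0 -> (u <= v)%MS.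
Proof.
move=> v_neq0 uv0; have [i vi_neq0] : exists i, v 0 i != 0.
  by apply/rV0Pn.
have [e0 e1 e2] := cross_coord u v.
move: e0 e1 e2; rewrite uv0 !mxE => /esym/subr0_eq e0 /esym/subr0_eq e1.
move=> /esym/subr0_eq e2.
(* The coordinates of the cross product are, up to sign, all the 2 x 2 minors of [u] and [v]. *)
have uv_comm : forall i j, u 0 i * v 0 j = u 0 j * v 0 i.
  by apply: ord3P; apply: ord3P.
apply/sub_rVP; exists (u 0 i / v 0 i); apply/rowP => j.
by rewrite mxE mulrAC uv_comm mulfK.
Qed.

Lemma eq_point_cross u v : u != 0 -> v != 0 -> (u == v)%MS = (u *v v == 0).
Proof.
move=> u_neq0 v_neq0; apply/andP/eqP => [[/sub_rVP[r ->] _] | uv0].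
  by rewrite crossZl crossvv scaler0.
by split; apply: sub_cross0 => //; rewrite crossC uv0 oppr0.
Qed.

Lemma line_lincomb a b x : a *v b != 0 -> dot (a *v b) x = 0 ->
  exists s t, x = s *: a + t *: b.
Proof.
(* This [e] lies off the line ab, so the coefficient of [x] in Cramer's relation is invertible. *)
move=> /rV0Pn[i abi_neq0] abx0; set e : 'rV[K]_3 := delta_mx 0 i.
have dot_e u : dot u e = u 0 i.
  rewrite /dot (bigD1 i) //= big1 => [|j /negPf ji]; rewrite !mxE ?eqxx ?ji.
    by rewrite mulr1 addr0.
  by rewrite mulr0.
have := scale_basis_expansion a b x e.
rewrite abx0 scale0r addr0 !dot_e => /(congr1 (GRing.scale ((a *v b) 0 i)^-1)).
rewrite scalerA mulVf // scale1r scalerDr !scalerA => ->.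
by do 2!eexists.
Qed.

Lemma eq_lincomb a b s t m n : a *v b != 0 ->
  s *: a + t *: b != 0 -> m *: a + n *: b != 0 ->
  ((s *: a + t *: b)%R == (m *: a + n *: b)%R)%MS = (m * t - n * s == 0).
Proof.
move=> ab_neq0 x_neq0 u_neq0.
rewrite eq_point_cross // cross_lincomb scaler_eq0 (negPf ab_neq0) orbF.
by rewrite -oppr_eq0 opprB ![s * _]mulrC ![t * _]mulrC.
Qed.

(** The case s = 0 is included: f is then a nonzero constant, its root having gone to infinity. *)
Lemma mup0_linear (r s : K) : (r != 0) || (s != 0) ->
  let f := r%:P + s%:P * 'X in f != 0 /\ mup 0 f = (r == 0) :> nat.
Proof.
case: (eqVneq r 0) => [-> /= s_neq0 | r_neq0 _].
  rewrite add0r -size_poly_eq0 size_Cmul // size_polyX; split=> //.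
  rewrite mupMr ?rootC // -['X]subr0 -[_ - _]expr1.
  by have := mup_XsubCX 1 (0 : K) 0; rewrite eqxx expr1.
have f0 : ~~ root (r%:P + s%:P * 'X) 0 by rewrite rootE !hornerE.
split; last exact: mupNroot.
by apply: contraNneq f0 => ->; rewrite root0.
Qed.

(* [m t - n s] is the bracket of the points [m a + n b] and [s a + t b] of the
   line [ab]. *)
Lemma mup0_point a b s t s' t' m n :
  let x := s *: a + t *: b in let z := s' *: a + t' *: b in
  let u := m *: a + n *: b in
  x *v z != 0 -> u != 0 ->
  let f := (m * t - n * s)%:P + (m * t' - n * s')%:P * 'X in
  f != 0 /\ mup 0 f = (x == u)%MS :> nat.
Proof.
move=> x z u xz_neq0 u_neq0.
have x_neq0 : x != 0 by apply: contraNneq xz_neq0 => ->; rewrite cross0v.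
move: xz_neq0; rewrite cross_lincomb scaler_eq0 negb_or => /andP[det_neq0 ab].
rewrite eq_lincomb //; apply: mup0_linear; rewrite -negb_and.
apply: contraNN u_neq0 => /andP[/eqP e1 /eqP e2].
(* If both coefficients of [f] vanished, Cramer's rule would give m = n = 0, since x and z are
   independent. *)
have /eqP : m * (s * t' - t * s') = 0.
  transitivity (s * (m * t' - n * s') - s' * (m * t - n * s)); first by ring.
  by rewrite e1 e2 !mulr0 subrr.
have /eqP : n * (s * t' - t * s') = 0.
  transitivity (t * (m * t' - n * s') - t' * (m * t - n * s)); first by ring.
  by rewrite e1 e2 !mulr0 subrr.
rewrite !mulf_eq0 (negPf det_neq0) !orbF /u => /eqP-> /eqP->.
by rewrite !scale0r addr0.
Qed.

Lemma restrict_cubic_form a a1 b b1 c k A B C x z :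
  let cst := map_mx (polyC (R := K)) in
  restrict_line (cubic_form a a1 b b1 c k A B C) x z =
  cubic_expr (cst a) (cst a1) (cst b) (cst b1) (cst c) (cst k)
    (cst A) (cst B) (cst C) (cst x + 'X *: cst z).
Proof.
(* Substitution is a ring morphism, so it acts on the data: constants stay constant and the generic
   point becomes x + T z. *)
rewrite /restrict_line /cubic_form map_cubic_expr /=.
have mapC u : map_mx (mmap (polyC (R := K))
    (fun i => (x 0 i)%:P + (z 0 i)%:P * 'X)) (map_mx (mpolyC 3 (R := K)) u) =
    map_mx polyC u by apply/rowP => i; rewrite !mxE mmapC.
rewrite !mapC; congr cubic_expr.
by apply/rowP => i; rewrite !mxE mmapX mmap1U mulrC.
Qed.

Lemma restrict_cubic_form_line a a1 b b1 c k A B C s t s' t' :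
  let q := (a *v b *v A *v a1) *v (a *v b *v B *v k *v C *v b1) *v c in
  let la := dot a q in let lb := dot b q in
  restrict_line (cubic_form a a1 b b1 c k A B C)
    (s *: a + t *: b) (s' *: a + t' *: b) =
  (s%:P + s'%:P * 'X) * (t%:P + t'%:P * 'X) *
  ((s * la + t * lb)%:P + (s' * la + t' * lb)%:P * 'X).
Proof.
move=> q la lb; rewrite restrict_cubic_form.
(* The moving point is a combination of [a] and [b] with coefficients in K[T], so [cubic_expr_line]
   applies over that ring. *)
have -> :
    map_mx polyC (s *: a + t *: b) + 'X *: map_mx polyC (s' *: a + t' *: b) =
    (s%:P + s'%:P * 'X) *: map_mx polyC a +
    (t%:P + t'%:P * 'X) *: map_mx polyC b.
  by apply/rowP => i; rewrite !mxE !polyCD !polyCM; ring.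
rewrite cubic_expr_line -!map_cross !dot_map -/q -/la -/lb.
by rewrite !polyCD !polyCM; ring.
Qed.

Lemma cubic_form_homog a a1 b b1 c k A B C :
  cubic_form a a1 b b1 c k A B C \is 3.-homog.
Proof.
have hC := @mpolyC_homog 3 K.
have hX i : (\row_(i < 3) 'X_i : 'rV[{mpoly K[3]}]_3) 0 i \is 1.-homog.
  by rewrite mxE dhomogX /= mdeg1.
(* Each of the three lines has degree 1 in the generic point, as joins and meets with constants
   preserve the degree. *)
apply: (@dot_homog _ _ 1 2).
  by do 3!apply: (@cross_homog _ _ 1 0) => //.
apply: (@cross_homog _ _ 1 1); last exact: (@cross_homog _ _ 1 0).
by do 5!apply: (@cross_homog _ _ 1 0) => //.
Qed.

End Line.

Theorem theorem4p1 (K : fieldType) (a a1 b b1 c k A B C : 'rV[K]_3)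
    (concABC : bracket A B C = 0)
    (genpos : general_position a a1 b b1 c k A B C) :
  let p := (a *v b *v A *v a1) *v (a *v b *v B *v k *v C *v b1) in
  [/\ cubic_curve a a1 b b1 c k A B C a,
      cubic_curve a a1 b b1 c k A B C b
    & is_third_point (cubic_form a a1 b b1 c k A B C) a b
        ((p *v c) *v (a *v b))].
Proof.
move=> p; have [ab_neq0 y_neq0] : a *v b != 0 /\ p *v c *v (a *v b) != 0.
  case: genpos => _ _; rewrite !inE !negb_or => /and3P[h _ _] _ /and3P[_ _ h'].
  by rewrite eq_sym h eq_sym h'.
have on_a : cubic_curve a a1 b b1 c k A B C a.
  by rewrite /cubic_curve /cubic_expr crossvv !cross0v bracket0l.
have on_b : cubic_curve a a1 b b1 c k A B C b.
  by rewrite /cubic_curve /cubic_expr crossvv !cross0v bracket0m.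
have aE : a = 1 *: a + 0 *: b by rewrite scale1r scale0r addr0.
have bE : b = 0 *: a + 1 *: b by rewrite scale1r scale0r add0r.
have a_neq0 : a != 0 by apply: contraNneq ab_neq0 => ->; rewrite cross0v.
have b_neq0 : b != 0.
  by apply: contraNneq ab_neq0 => ->; rewrite crossC cross0v oppr0.
have yE := double_cross (p *v c) a b.
have key x z : dot (a *v b) x = 0 -> dot (a *v b) z = 0 -> x *v z != 0 ->
    restrict_line (cubic_form a a1 b b1 c k A B C) x z != 0 /\
    mup 0 (restrict_line (cubic_form a a1 b b1 c k A B C) x z) =
    ((x == a)%MS + (x == b)%MS + (x == p *v c *v (a *v b))%MS)%N.
  move=> /(line_lincomb ab_neq0)[s [t ->]] /(line_lincomb ab_neq0)[s' [t' ->]].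
  move=> xz_neq0.
  have fa := mup0_point (m := 1) (n := 0) xz_neq0.
  have fb := mup0_point (m := 0) (n := 1) xz_neq0.
  (* These are the coordinates of the third point read off from [yE]. *)
  have fy := mup0_point (m := dot b (p *v c)) (n := - dot a (p *v c)) xz_neq0.
  rewrite -aE in fa; rewrite -bE in fb; rewrite -yE in fy.
  have [fa_neq0 <-] := fa a_neq0; have [fb_neq0 <-] := fb b_neq0.
  have [fy_neq0 <-] := fy y_neq0.
  (* Multiplicities add over a product of nonzero factors, so coincidences among [a], [b] and the
     third point need no separate treatment. *)
  rewrite -!mupM ?mulf_neq0 //; set G := (X in _ = mup 0 X).
  (* The sign comes from the factor for [b], where m = 0 and n = 1 give - (s + s' T). *)
  have -> : restrict_line (cubic_form a a1 b b1 c k A B C)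
      (s *: a + t *: b) (s' *: a + t' *: b) = (-1)%:P * G.
    rewrite restrict_cubic_form_line -/p /G.
    by rewrite !(polyCD, polyCM, polyCN, polyC0); ring.
  have N1_neq0 : (-1 : K) != 0 by rewrite oppr_eq0 oner_eq0.
  have G_neq0 : G != 0 by rewrite /G !mulf_neq0.
  by rewrite mupMr ?rootC // mulf_neq0 ?polyC_eq0.
split=> //; split.
- exact: cubic_form_homog.
- by have [] := key a b (dot_crossl a b) (dot_crossr a b) ab_neq0.
- by split=> //; exact: dot_double_cross.
- by move=> x z hx hz /(key x z hx hz)[].
Qed.
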